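(* Let $m\ge4$ be even and let $a,b$ be integers of the same parity with $1\le a<b<m$. Then $B_3(m;a,b)$ is a nut graph if and only if $a$ and $b$ are odd, $\gcd(m,a)=\gcd(m,b)=1$ and $v_2(b-a)\ge v_2(m)$.
   Context: A graph is a nut graph if $0$ is an adjacency eigenvalue of multiplicity one and a corresponding eigenvector has no zero entries. $B_3(m;a,b)$ is the graph on vertices $x_0,\dots,x_{m-1},y_0,\dots,y_{m-1}$ (indices mod $m$) with edges $x_ix_{i+m/2}$, $y_iy_{i+m/2}$, $x_iy_i$, $x_iy_{i+a}$ and $x_iy_{i+b}$ for all $i$. For a nonzero integer $x$, $v_2(x)$ is the exponent of $2$ in the prime factorization of $|x|$. *)

(* Defs.v *)
From mathcomp Require Import all_boot all_order all_algebra.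
From mathcomp Require Import reals.
Set Implicit Arguments.
Unset Strict Implicit.
Unset Printing Implicit Defensive.
Import GRing.Theory.
Local Open Scope ring_scope.

(* A simple graph on the finite vertex type T is given by its adjacency
   relation e : rel T, symmetric and irreflexive. *)
Definition adj_mx (R : fieldType) (T : finType) (e : rel T) : 'M[R]_#|T| :=
  \matrix_(i, j) (e (enum_val i) (enum_val j))%:R.

(* Multiplicity means the multiplicity of 0 as a root of the characteristic
   polynomial. Library eigenvectors are row vectors; this is harmless since
   adj_mx R e is symmetric. *)
Definition nut_graph (R : fieldType) (T : finType) (e : rel T) : Prop :=
  mup 0 (char_poly (adj_mx R e)) = 1%N /\
  exists v : 'rV[R]_#|T|,
    [/\ v != 0, (v <= eigenspace (adj_mx R e) 0)%MS & forall i, v 0 i != 0].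

Local Open Scope nat_scope.

(* inl i stands for x_i and inr i for y_i. *)
Definition B3_arc (m a b : nat) : rel ('I_m + 'I_m) := fun u v =>
  match u, v with
  | inl i, inl j => j == i + m./2 %[mod m]
  | inr i, inr j => j == i + m./2 %[mod m]
  | inl i, inr j =>
      [|| j == i %[mod m], j == i + a %[mod m] | j == i + b %[mod m]]
  | inr _, inl _ => false
  end.

Definition B3 (m a b : nat) : rel ('I_m + 'I_m) := fun u v =>
  B3_arc a b u v || B3_arc a b v u.

Lemma B3_sym (m a b : nat) : symmetric (@B3 m a b).
Proof. by move=> u v; rewrite /B3 orbC. Qed.

Lemma B3_irrefl (m a b : nat) : 1 < m -> irreflexive (@B3 m a b).
Proof.
move=> m_gt1 u; rewrite /B3 orbb.
have half_ltn : m./2 < m by rewrite ltn_half_double -addnn -ltn_subLR // subnn ltnW.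
have half_n0 : m./2 != 0 by rewrite -lt0n half_gt0.
have shift_neq (i : 'I_m) : (i == i + m./2 %[mod m]) = false.
  by rewrite -[X in X == _ %[mod m]]addn0 eqn_modDl mod0n modn_small // eq_sym (negPf half_n0).
by case: u => i; apply: shift_neq.
Qed.

(* Main.v *)
(** Let S be the cyclic shift on functions Z/m -> R. Since S^(m/2) is an
    involution, an element of the kernel of the adjacency matrix is determined
    by its y-part Y, and eliminating the x-part leaves (C^T C - 1) Y = 0 with
    C = 1 + S^a + S^b, that is
      (1 + S^a) (1 + S^b) (1 + S^(b-a)) Y = 0.
    If v_2(b-a) >= v_2(m) the last factor is injective, and if a and b are
    coprime to m the first two leave only the multiples of (-1)^i. Otherwise a
    nonzero solution with a zero entry shows that the graph is not nut. The
    algebraic multiplicity is the nullity by the spectral theorem. *)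
Require Import Defs.
From mathcomp Require Import all_boot all_order all_algebra.
From mathcomp Require Import reals.
From mathcomp Require Import complex.
From mathcomp Require Import ring lra zify.
Import GRing.Theory Num.Theory.
Set Implicit Arguments.
Unset Strict Implicit.
Unset Printing Implicit Defensive.
Local Open Scope ring_scope.

(** * Algebraic multiplicity and nullity of real symmetric matrices *)

Lemma mup_map_poly (F K : fieldType) (f : {rmorphism F -> K}) (x : F)
  (p : {poly F}) : p != 0 -> mup (f x) (map_poly f p) = mup x p.
Proof.
move=> p0; have mup_geE n : (n <= mup (f x) (map_poly f p))%N = (n <= mup x p)%N.
  by rewrite !mup_geq ?map_poly_eq0 // -map_polyXsubC -rmorphXn dvdp_map.
by apply/eqP; rewrite eqn_leq -mup_geE leqnn mup_geE leqnn.
Qed.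

Lemma mxrank_diag (F : fieldType) n (d : 'rV[F]_n) :
  \rank (diag_mx d) = #|[pred i | d 0 i != 0]|.
Proof.
pose S := (\sum_(i | d 0 i != 0) <<delta_mx 0 i : 'rV[F]_n>>)%MS.
have -> : \rank (diag_mx d) = \rank S.
  apply/eqmx_rank/andP; split.
    apply/row_subP => i; rewrite row_diag_mx.
    have [->|di0] := eqVneq (d 0 i) 0; first by rewrite scale0r sub0mx.
    by apply/scalemx_sub/(sumsmx_sup i); rewrite // genmxE.
  apply/sumsmx_subP => i di0; rewrite genmxE.
  rewrite -[delta_mx _ _](scalerK di0) -row_diag_mx.
  exact/scalemx_sub/row_sub.
have /mxdirectP -> : mxdirect S by apply: mxdirect_delta => i j _ _.
rewrite /= -sum1_card; apply: eq_bigr => i _.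
by rewrite mxrank_gen mxrank_delta.
Qed.

Lemma char_poly_conj (F : fieldType) n (P A B : 'M[F]_n) :
  P \in unitmx -> A = invmx P *m B *m P -> char_poly A = char_poly B.
Proof.
move=> uP ->; rewrite /char_poly /char_poly_mx.
set f := @polyC F.
have uPf : map_mx f (invmx P) *m map_mx f P = 1%:M.
  by rewrite -map_mxM mulVmx // map_mx1.
have -> : 'X%:M - map_mx f (invmx P *m B *m P) =
    map_mx f (invmx P) *m ('X%:M - map_mx f B) *m map_mx f P.
  rewrite mulmxBr mulmxBl -!map_mxM; congr (_ - _).
  by rewrite mul_mx_scalar -scalemxAl uPf scalemx1.
by rewrite !det_mulmx mulrAC -det_mulmx uPf det1 mul1r.
Qed.

(** Over [R[i]] the matrix is hermitian, hence normal and diagonalizable. The multiplicity then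
    counts the zero diagonal entries and the rank the nonzero ones; both are invariant under the
    field embedding. *)
Lemma mup0_char_poly_sym (R : rcfType) n (A : 'M[R]_n) :
  A^T = A -> mup 0 (char_poly A) = \rank (kermx A).
Proof.
move=> symA; pose f := real_complex R; pose B := map_mx f A.
have nB : B \is normalmx.
  apply: symmetric_normalmx.
    by apply/is_hermitianmxP; rewrite expr0 scale1r map_mx_id // map_trmx symA.
  by apply/mxOverP => i j; rewrite mxE; rewrite complex_real.
rewrite mxrank_ker -(mup_map_poly f) ?monic_neq0 ?char_poly_monic //.
rewrite rmorph0 map_char_poly -(mxrank_map f) -/B.
have /orthomx_spectralP defB := nB; have uP := spectral_unit B.
rewrite (char_poly_conj uP defB) char_poly_trig; last first.
  exact/diag_mx_is_trig.
rewrite [in \rank _]defB mxrankMfree ?row_free_unit //.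
rewrite (eqmxMfull (diag_mx _)) ?row_full_unit ?unitmx_inv // mxrank_diag.
set d := spectral_diag B.
rewrite (eq_bigr (fun i => 'X - (d 0 i)%:P)); last first.
  by move=> i _; rewrite mxE eqxx.
rewrite -(big_map (d 0) predT (fun y => 'X - y%:P)) mu_prod_XsubC count_map.
rewrite -[X in (X - _)%N]card_ord -(cardC [pred i | d 0 i != 0]) addKn.
by rewrite -sum1_count -sum1_card; apply: eq_bigl => i; rewrite !inE negbK.
Qed.

(** * Kernel vectors as functions on the vertices *)

Definition adj_ker (R : fieldType) (T : finType) (e : rel T) (f : T -> R) :=
  forall t, \sum_u f u * (e u t)%:R = 0.

Lemma adj_kerP (R : fieldType) (T : finType) (e : rel T) (v : 'rV[R]_#|T|) :
  reflect (adj_ker e (fun t => v 0 (enum_rank t))) (v <= kermx (adj_mx R e))%MS.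
Proof.
have mulE t : (v *m adj_mx R e) 0 (enum_rank t) =
    \sum_u v 0 (enum_rank u) * (e u t)%:R.
  rewrite mxE (reindex_onto enum_rank enum_val) => [|i _]; last exact: enum_valK.
  under eq_bigl do rewrite enum_rankK eqxx.
  by apply: eq_bigr => u _; rewrite mxE !enum_rankK.
apply: (iffP sub_kermxP) => [v0 t|v0]; first by rewrite -mulE v0 mxE.
by apply/rowP => i; rewrite -(enum_valK i) mulE v0 mxE.
Qed.

Lemma nut_graphP (R : rcfType) (T : finType) (e : rel T) :
  symmetric e -> (0 < #|T|)%N ->
  nut_graph R e <-> exists f : T -> R, [/\ adj_ker e f, forall t, f t != 0 &
    forall g, adj_ker e g -> exists c, forall t, g t = c * f t].
Proof.
move=> syme T0; set A := adj_mx R e.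
have symA : A^T = A by apply/matrixP => i j; rewrite !mxE syme.
rewrite /nut_graph mup0_char_poly_sym // -/A /eigenspace raddf0 subr0.
split=> [[rk1 [v [v0 vA nz]]]|[f [fA nz fU]]].
  exists (fun t => v 0 (enum_rank t)); split=> [|t|g gA] //.
    exact/adj_kerP.
  pose w : 'rV[R]_#|T| := \row_i g (enum_val i).
  have /sub_rVP[c wE] : (w <= v)%MS.
    apply: submx_trans (_ : w <= kermx A)%MS _.
      apply/adj_kerP => t; rewrite -[RHS](gA t); apply: eq_bigr => u _.
      by rewrite mxE enum_rankK.
    (* The line of [v] lies in the kernel and has the same rank 1, so the two coincide. *)
    by have := mxrank_leqif_sup vA; rewrite rk1 rank_rV v0 => -[_ <-].
  exists c => t; have /rowP/(_ (enum_rank t)) := wE.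
  by rewrite !mxE enum_rankK.
pose v : 'rV[R]_#|T| := \row_i f (enum_val i).
have vE t : v 0 (enum_rank t) = f t by rewrite mxE enum_rankK.
have vA : (v <= kermx A)%MS.
  apply/adj_kerP => t; rewrite -[RHS](fA t); apply: eq_bigr => u _.
  by rewrite vE.
have v0 : v != 0.
  apply/eqP => /rowP/(_ (Ordinal T0))/eqP.
  by rewrite !mxE (negPf (nz _)).
have Av : (kermx A <= v)%MS.
  apply/row_subP => i; have /adj_kerP/fU[c rE] := row_sub i (kermx A).
  apply/sub_rVP; exists c; apply/rowP => j.
  by have := rE (enum_val j); rewrite !mxE enum_valK.
split; last by exists v; split=> // i; rewrite mxE.
by apply/eqP; rewrite eqn_leq (leq_trans (mxrankS Av)) ?rank_leq_row //
  (leq_trans _ (mxrankS vA)) // rank_rV v0.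
Qed.

Lemma sum_eq (R : pzRingType) (T : finType) (F : T -> R) u :
  \sum_i F i * (i == u)%:R = F u.
Proof.
rewrite (bigD1 u) //= eqxx mulr1 big1 ?addr0 // => i /negPf->.
by rewrite mulr0.
Qed.

Lemma sum_eq3 (R : pzRingType) (T : finType) (F : T -> R) u v w :
  u != v -> u != w -> v != w ->
  \sum_i F i * [|| i == u, i == v | i == w]%:R = F u + F v + F w.
Proof.
move=> uv uw vw; rewrite -!(sum_eq F) -!big_split; apply: eq_bigr => i _ /=.
rewrite -!mulrDr; congr (_ * _).
case: (eqVneq i u) => [->|_]; first by rewrite (negPf uv) (negPf uw) !addr0.
case: (eqVneq i v) => [->|_]; first by rewrite (negPf vw) add0r addr0.
by rewrite !add0r.
Qed.

(** * Kernel equations of the graph *)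

Section B3Kernel.

Variables (R : rcfType) (m a b : nat).
Hypotheses (m_gt0 : (0 < m)%N) (m_even : ~~ odd m).
Hypotheses (a_gt0 : (0 < a)%N) (a_lt_b : (a < b)%N) (b_lt_m : (b < m)%N).

Definition wrap k : 'I_m := Ordinal (ltn_pmod k m_gt0).

Lemma wrap_mod k l : (k = l %[mod m])%N -> wrap k = wrap l.
Proof. by move=> kl; apply: val_inj. Qed.

Lemma wrap_ord (i : 'I_m) : wrap i = i.
Proof. by apply: val_inj; rewrite /= modn_small. Qed.

Lemma eq_wrap (i : 'I_m) k : (i == wrap k) = (i == k %[mod m])%N.
Proof. by rewrite -val_eqE /= [in RHS]modn_small. Qed.

Lemma half_twice : (m./2 + m./2 = m)%N.
Proof. by rewrite addnn even_halfK. Qed.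

(** The equation at a vertex y is written at index [k + (a + b)], so that its neighbours x, reached
    by subtracting [a] or [b], have indices free of truncated subtraction. *)
Lemma adj_ker_B3 (f : 'I_m + 'I_m -> R)
    (X := fun k => f (inl (wrap k))) (Y := fun k => f (inr (wrap k))) :
  adj_ker (@B3 m a b) f <->
  (forall k, X (k + m./2)%N + (Y k + Y (k + a)%N + Y (k + b)%N) = 0) /\
  (forall k, Y (k + m./2 + (a + b))%N +
     (X (k + (a + b))%N + X (k + b)%N + X (k + a)%N) = 0).
Proof.
have half_sym (i j : nat) :
    (j == i + m./2 %[mod m])%N = (i == j + m./2 %[mod m])%N.
  by rewrite -(eqn_modDr m./2) -addnA half_twice modnDr eq_sym.
have neq k x y : (x < y)%N -> (y < m)%N -> wrap (k + x) != wrap (k + y).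
  move=> xy ym; rewrite -val_eqE /= eqn_modDl !modn_small ?(ltn_trans xy) //.
  by rewrite ltn_eqF.
have inlE k : \sum_u f u * (B3 a b u (inl (wrap k)))%:R =
    X (k + m./2)%N + (Y k + Y (k + a)%N + Y (k + b)%N).
  rewrite big_sumType /=; congr (_ + _).
    rewrite -[RHS](sum_eq (fun i => f (inl i))); apply: eq_bigr => i _.
    rewrite /B3 /= half_sym orbb eq_wrap; congr (_ * (_ == _)%:R).
    by rewrite modnDml.
  rewrite -(sum_eq3 (fun i => f (inr i))); last 3 first.
  - by rewrite -{1}(addn0 k) neq // (ltn_trans a_lt_b).
  - by rewrite -{1}(addn0 k) neq // (ltn_trans a_gt0).
  - by rewrite neq.
  apply: eq_bigr => i _; rewrite /B3 /= !eq_wrap.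
  by rewrite modn_mod !modnDml.
have inrE k : \sum_u f u * (B3 a b u (inr (wrap (k + (a + b)))))%:R =
    Y (k + m./2 + (a + b))%N +
      (X (k + (a + b))%N + X (k + b)%N + X (k + a)%N).
  rewrite big_sumType /= addrC; congr (_ + _).
    rewrite -[RHS](sum_eq (fun i => f (inr i))); apply: eq_bigr => i _.
    rewrite /B3 /= half_sym orbb eq_wrap; congr (_ * (_ == _)%:R).
    by rewrite modnDml addnAC.
  rewrite -(sum_eq3 (fun i => f (inl i))); last 3 first.
  - rewrite eq_sym (addnC a) addnA -[X in wrap X != _]addn0 neq //.
    exact: ltn_trans b_lt_m.
  - rewrite eq_sym addnA -[X in wrap X != _]addn0 neq //.
    exact: ltn_trans a_lt_b.
  - by rewrite eq_sym neq.
  apply: eq_bigr => i _; rewrite /B3 /= !orbF !eq_wrap.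
  rewrite modn_mod ![(_ == i + _ %[mod m])%N]eq_sym.
  rewrite -(eqn_modDr a i (k + b)) -(eqn_modDr b i (k + a)).
  by rewrite -!addnA (addnC b a) [in LHS]eq_sym.
split=> [fA|[eqX eqY] [i|i]].
- by split=> k; [rewrite -inlE | rewrite -inrE].
- by rewrite -(wrap_ord i) inlE.
(* Adding the multiple [m * (a + b)] first makes the natural-number subtraction exact and leaves the
   residue mod [m] unchanged. *)
- pose k := (i + m * (a + b) - (a + b))%N.
  have -> : i = wrap (k + (a + b)).
    rewrite subnK; last by rewrite -[leqLHS]mul1n -[leqLHS]add0n leq_add // leq_mul.
    by rewrite -{1}(wrap_ord i); apply/wrap_mod; rewrite addnC mulnC modnMDl.
  by rewrite inrE.
Qed.

(** * Shift operators and elimination of the x-part *)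

Definition shift_add c (Y : nat -> R) i := Y i + Y (i + c)%N.
Definition periodic (Y : nat -> R) := forall i, Y (i + m)%N = Y i.
(** Since [shift_add c] is the operator 1 + S^c, this is the factored equation for the y-part. *)
Definition in_ker Y :=
  forall i, shift_add a (shift_add b (shift_add (b - a) Y)) i = 0.

Lemma periodic_mod Y k l : periodic Y -> (k = l %[mod m])%N -> Y k = Y l.
Proof.
move=> perY kl; have mulY q i : Y (i + q * m)%N = Y i.
  by elim: q => [|q IHq]; rewrite ?addn0 // mulSn addnCA addnC perY.
by rewrite (divn_eq k m) (divn_eq l m) kl ![(_ * m + _)%N]addnC !mulY.
Qed.

Lemma periodic_shift_add Y c : periodic Y -> periodic (shift_add c Y).
Proof. by move=> perY i; rewrite /shift_add addnAC !perY. Qed.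

Lemma periodic_wrap (f : 'I_m -> R) : periodic (fun k => f (wrap k)).
Proof. by move=> i; congr f; apply: wrap_mod; rewrite modnDr. Qed.

Lemma periodic_eq0 Y c :
  periodic Y -> (forall k, Y (k + c)%N = 0) -> forall i, Y i = 0.
Proof.
(* Shifting by [c * m.-1] undoes the shift by [c], as the total [c * m] is a multiple of the
   period. *)
move=> perY Y0 i; rewrite -(Y0 (i + c * m.-1)%N); apply: periodic_mod => //.
by rewrite -addnA -mulnSr prednK // addnC modnMDl.
Qed.

(** The x-part forced by the equation at x_(k + m/2), that is - S^(m/2) C Y. *)
Definition inl_part (Y : nat -> R) k :=
  - (Y (k + m./2)%N + Y (k + m./2 + a)%N + Y (k + m./2 + b)%N).

(* C^T C - 1 = S^(-a-b) (1 + S^a) (1 + S^b) (S^a + S^b). *)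
Lemma inl_part_elim Y k : periodic Y ->
  Y (k + m./2 + (a + b))%N + (inl_part Y (k + (a + b)) +
    inl_part Y (k + b) + inl_part Y (k + a)) =
  - shift_add a (shift_add b (shift_add (b - a) Y)) (k + m./2 + a)%N.
Proof.
move=> perY; rewrite /inl_part /shift_add.
set h := m./2; pose d := (b - a)%N.
have bE : b = (a + d)%N by rewrite subnKC // ltnW.
rewrite -/d bE; set i := (k + h)%N.
have e1 : (k + (a + (a + d)) + h = i + (a + (a + d)))%N by rewrite /i; lia.
have e2 : (k + (a + d) + h = i + (a + d))%N by rewrite /i; lia.
have e3 : (k + a + h = i + a)%N by rewrite /i; lia.
rewrite {}e1 {}e2 {}e3; clearbody i.
(* The following equalities identify terms whose indices differ only in form; what remains is
   linear. *)
have YE x y : x = y -> Y x = Y y by move->.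
have e1 := YE (i + a + d)%N (i + (a + d))%N ltac:(lia).
have e2 := YE (i + (a + d) + (a + d))%N (i + a + (a + d) + d)%N ltac:(lia).
have e3 := YE (i + a + (a + d))%N (i + (a + (a + d)))%N ltac:(lia).
have e4 := YE (i + (a + (a + d)) + a)%N (i + a + a + (a + d))%N ltac:(lia).
have e5 := YE (i + (a + (a + d)) + (a + d))%N (i + a + a + (a + d) + d)%N ltac:(lia).
have e6 := YE (i + (a + d) + a)%N (i + (a + (a + d)))%N ltac:(lia).
have e7 := YE (i + a + a + d)%N (i + (a + (a + d)))%N ltac:(lia).
lra.
Qed.

Lemma inl_partE (f : 'I_m + 'I_m -> R) j : adj_ker (@B3 m a b) f ->
  f (inl (wrap j)) = inl_part (fun k => f (inr (wrap k))) j.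
Proof.
case/adj_ker_B3 => /(_ (j + m./2)%N) + _.
rewrite -[in inl _]addnA half_twice (@wrap_mod _ j) ?modnDr //.
by move/eqP; rewrite addr_eq0 => /eqP.
Qed.

(** Elimination gives the equation at indices [k + m./2 + a] only; periodicity carries it to all
    indices. *)
Lemma in_ker_inr (f : 'I_m + 'I_m -> R) :
  adj_ker (@B3 m a b) f -> in_ker (fun k => f (inr (wrap k))).
Proof.
move=> fA; set Y := fun k => _.
have perY : periodic Y by apply: (@periodic_wrap (fun i => f (inr i))).
apply: (@periodic_eq0 _ (m./2 + a)%N) => [|k].
  by do 3!apply: periodic_shift_add.
have [_ /(_ k)] := (adj_ker_B3 f).1 fA.
rewrite !(inl_partE _ fA) inl_part_elim // -addnA => /eqP.
by rewrite oppr_eq0 => /eqP.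
Qed.

Definition ker_ext (Y : nat -> R) (u : 'I_m + 'I_m) :=
  match u with inl i => inl_part Y i | inr i => Y i end.

Lemma ker_extP Y : periodic Y -> in_ker Y -> adj_ker (@B3 m a b) (ker_ext Y).
Proof.
move=> perY kerY.
have YE k : ker_ext Y (inr (wrap k)) = Y k.
  by apply: periodic_mod; rewrite ?modn_mod.
have XE k : ker_ext Y (inl (wrap k)) = inl_part Y k.
  by congr (- (_ + _ + _)); apply: periodic_mod; rewrite // -?addnA modnDml.
apply/adj_ker_B3; split=> k; rewrite !XE !YE.
  rewrite /inl_part -addnA half_twice addrC !(addnAC _ m) !perY.
  exact: subrr.
by rewrite inl_part_elim // kerY oppr0.
Qed.

(** * The nut property read off from the y-part *)

Lemma nut_in_ker : nut_graph R (@B3 m a b) -> exists Y,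
  [/\ periodic Y, in_ker Y, forall i, Y i != 0 & forall Z,
    periodic Z -> in_ker Z -> exists c, forall i, Z i = c * Y i].
Proof.
case/nut_graphP => [||f [fA nz fU]]; first exact: B3_sym.
  by rewrite card_sum card_ord addn_gt0 m_gt0.
exists (fun k => f (inr (wrap k))); split=> [||i|Z perZ kerZ] //.
- exact: (@periodic_wrap (fun i => f (inr i))).
- exact: in_ker_inr.
have [c ZE] := fU _ (ker_extP perZ kerZ); exists c => i; rewrite -ZE /=.
by apply: periodic_mod; rewrite ?modn_mod.
Qed.

(** Every solution is a multiple of a nowhere zero one. Each necessary condition is obtained from
    this by exhibiting a solution that vanishes at 1 but not at 0. *)
Lemma nut_ker_eq0 Z i j : nut_graph R (@B3 m a b) ->
  periodic Z -> in_ker Z -> Z i = 0 -> Z j = 0.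
Proof.
case/nut_in_ker => Y [_ _ nzY YU] perZ kerZ.
have [c ZE] := YU Z perZ kerZ; rewrite !ZE => /eqP.
by rewrite mulf_eq0 (negPf (nzY i)) orbF => /eqP->; rewrite mul0r.
Qed.

Lemma nut_of_sign : odd a -> odd b ->
  (forall Z, periodic Z -> in_ker Z -> exists c, forall i, Z i = c * (-1) ^+ i) ->
  nut_graph R (@B3 m a b).
Proof.
move=> odda oddb Zsign; pose Y i : R := (-1) ^+ i.
have signDodd i c : odd c -> (-1) ^+ (i + c) = - (-1) ^+ i :> R.
  by move=> oddc; rewrite exprD -(signr_odd _ c) oddc mulrN1.
have perY : periodic Y.
  by move=> i; rewrite /Y exprD -(signr_odd _ m) (negPf m_even) mulr1.
have kerY : in_ker Y.
  move=> i; rewrite /shift_add /Y.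
  have signDd k : (-1) ^+ (k + (b - a)) = (-1) ^+ k :> R.
    by rewrite exprD -(signr_odd _ (b - a)) oddB ?(ltnW a_lt_b) // odda oddb mulr1.
  by rewrite !signDd !(signDodd _ a, signDodd _ b) //; lra.
(* With [a] and [b] odd, the three terms are s, -s, -s, whose negated sum is s: the x-part has no
   zero entry either. *)
have XE k : inl_part Y k = (-1) ^+ (k + m./2).
  by rewrite /inl_part /Y !(signDodd _ a odda, signDodd _ b oddb); lra.
apply/nut_graphP; first exact: B3_sym.
  by rewrite card_sum card_ord addn_gt0 m_gt0.
exists (ker_ext Y); split=> [|[i|i]|g gA]; first exact: ker_extP.
- by rewrite /= XE signr_eq0.
- by rewrite /= /Y signr_eq0.
have [c gE] := Zsign _ (@periodic_wrap (fun i => g (inr i))) (in_ker_inr gA).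
exists c => -[i|i] /=; last by rewrite -{1}(wrap_ord i) gE.
by rewrite -{1}(wrap_ord i) inl_partE // /inl_part !gE -!mulrDr -mulrN.
Qed.

(** * Sequences annihilated by one factor or by all three *)

(** The three operators commute, so any of them can be applied first. *)
Lemma in_ker_shift_add c Z : c \in [:: a; b; (b - a)%N] ->
  (forall i, shift_add c Z i = 0) -> in_ker Z.
Proof.
pose d := (b - a)%N; have bE : b = (a + d)%N by rewrite subnKC // ltnW.
rewrite !inE /in_ker -/d => /or3P[] /eqP-> Z0 i; move: Z0; rewrite /shift_add.
- move=> Z0; have ZE x y : x = y -> Z x = Z y by move->.
  have e1 := ZE (i + b + a)%N (i + a + b)%N ltac:(lia).
  have e2 := ZE (i + d + a)%N (i + a + d)%N ltac:(lia).
  have e3 := ZE (i + b + d + a)%N (i + a + b + d)%N ltac:(lia).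
  have h1 := Z0 i; have h2 := Z0 (i + b)%N; have h3 := Z0 (i + d)%N.
  by have h4 := Z0 (i + b + d)%N; lra.
- move=> Z0; have ZE x y : x = y -> Z x = Z y by move->.
  have e1 := ZE (i + d + b)%N (i + b + d)%N ltac:(lia).
  have e2 := ZE (i + a + d + b)%N (i + a + b + d)%N ltac:(lia).
  have h1 := Z0 i; have h2 := Z0 (i + a)%N; have h3 := Z0 (i + d)%N.
  by have h4 := Z0 (i + a + d)%N; lra.
by move=> Z0; rewrite !Z0 !addr0.
Qed.

Lemma shift_add_iter c V : (forall i, shift_add c V i = 0) ->
  forall i k, V (i + k * c)%N = (-1) ^+ k * V i.
Proof.
move=> V0 i; elim=> [|k IHk]; first by rewrite addn0 mul1r.
rewrite mulSnr addnA exprS mulN1r mulNr -IHk; apply/eqP.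
by rewrite -addr_eq0 addrC; apply/eqP/V0.
Qed.

(* Iterating V (i + c) = - V i an odd number m' of times with m | m' * c gives
   V i = - V i. *)
Lemma shift_add_inj c V : (0 < c)%N -> (logn 2 m <= logn 2 c)%N ->
  periodic V -> (forall i, shift_add c V i = 0) -> forall i, V i = 0.
Proof.
move=> c_gt0 le_mc perV V0 i; have := shift_add_iter V0 i m`_(2%N)^'.
rewrite -signr_odd odd_2'nat part_pnat mulN1r (@periodic_mod _ _ i) //; last first.
  suff /dvdnP[q ->] : (m %| m`_(2%N)^' * c)%N by rewrite addnC modnMDl.
  (* After cancelling the odd part of [m], it remains that the 2-part of [m] divides [c]. *)
  rewrite -{1}(partnC 2%N m_gt0) mulnC dvdn_pmul2l ?part_gt0 //.
  by rewrite p_part pfactor_dvdn.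
by move/eqP; rewrite -subr_eq0 opprK -mulr2n mulrn_eq0 => /eqP.
Qed.

(** Bezout provides [k]; it is odd because the even number [m] divides [1 + k * c]. *)
Lemma coprime_step_odd c : coprime m c -> exists2 k, odd k & (m %| 1 + k * c)%N.
Proof.
rewrite /coprime => /eqP co; have [k _] := Bezoutl c m_gt0.
rewrite co => dvd_m; exists k => //.
have : ~~ odd (1 + k * c) by rewrite -dvdn2 (dvdn_trans _ dvd_m) // dvdn2.
by rewrite oddD oddM; case: (odd k).
Qed.

(** An odd number [k] of steps by [c] amounts to one step by -1 mod [m], so a single step also
    changes the sign. *)
Lemma shift_add_sign c V : coprime m c -> periodic V ->
  (forall i, shift_add c V i = 0) -> forall i, V i = V 0%N * (-1) ^+ i.
Proof.
move=> /coprime_step_odd[k oddk dvd_m] perV V0.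
have VS i : V i.+1 = - V i.
  have := shift_add_iter V0 i.+1 k; rewrite -signr_odd oddk mulN1r.
  rewrite (@periodic_mod _ _ i) // => [->|]; first by rewrite opprK.
  by rewrite -addn1 -addnA; case/dvdnP: dvd_m => q ->; rewrite addnC modnMDl.
by elim=> [|i IHi]; rewrite ?mulr1 // VS IHi exprS mulN1r mulrN.
Qed.

(** The factors are removed one by one: the one for [b - a] is injective, the one for [a] makes (1 +
    S^b) Z alternate with some amplitude [c], and once [c = 0] the one for [b] makes [Z]
    alternate. *)
Lemma in_ker_sign Z : coprime m a -> coprime m b ->
  (logn 2 m <= logn 2 (b - a))%N -> periodic Z -> in_ker Z ->
  forall i, Z i = Z 0%N * (-1) ^+ i.
Proof.
move=> co_a co_b le_v2 perZ kerZ.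
have abZ : forall i, shift_add a (shift_add b Z) i = 0.
  apply: (@shift_add_inj (b - a)) => //; rewrite ?subn_gt0 //.
    by do 2!apply: periodic_shift_add.
  move=> i; rewrite -[RHS](kerZ i) /shift_add.
  have ZE x y : x = y -> Z x = Z y by move->.
  set d := (b - a)%N.
  have e1 := ZE (i + d + b)%N (i + b + d)%N ltac:(lia).
  have e2 := ZE (i + d + a)%N (i + a + d)%N ltac:(lia).
  have e3 := ZE (i + d + a + b)%N (i + a + b + d)%N ltac:(lia).
  lra.
have bZ := shift_add_sign co_a (periodic_shift_add b perZ) abZ.
set c := shift_add b Z 0 in bZ.
have oddb : odd b.
  have : coprime 2 b by apply: coprime_dvdl co_b; rewrite dvdn2.
  by rewrite coprime2n.
(* The generalized eigenspace is excluded: the drift in k of this formula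
   contradicts periodicity unless c = 0. *)
have Zk k i : Z (i + k * b)%N = (-1) ^+ k * (Z i - k%:R * (c * (-1) ^+ i)).
  elim: k => [|k IHk]; first by rewrite addn0 mul0r subr0 mul1r.
  have := bZ (i + k * b)%N; rewrite /shift_add IHk -addnA -mulSnr.
  rewrite exprD -(signr_odd _ (k * b)) oddM oddb andbT signr_odd => H.
  apply: (addrI ((-1) ^+ k * (Z i - k%:R * (c * (-1) ^+ i)))).
  by rewrite H -natr1 exprS; ring.
have c0 : c = 0.
  (* After [m] steps by [b] the sequence is back at its start and, [m] being even, the sign is 1;
     hence [m%:R * c = 0]. *)
  have := Zk m 0%N; rewrite (@periodic_mod _ _ 0%N) ?add0n ?modnMr ?mod0n //.
  rewrite -signr_odd (negPf m_even) !mulr1 mul1r => /eqP.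
  rewrite -subr_eq0 opprB addrC subrK mulf_eq0 pnatr_eq0.
  by rewrite -(negbK (m == 0)%N) -lt0n m_gt0 => /eqP.
by apply: (shift_add_sign co_b perZ) => i; rewrite bZ c0 mul0r.
Qed.

(** * Necessity of the arithmetic conditions *)

(** If [a] and [b] were even, all shifts, including the period, would preserve the parity of the
    index, so erasing the odd entries of a solution would give a solution. *)
Lemma nut_odd : odd a = odd b -> nut_graph R (@B3 m a b) -> odd a.
Proof.
move=> odd_ab nutG; apply/negPn/negP => even_a.
have even_b : odd b = false by rewrite -odd_ab; apply: negPf.
have [Y [perY kerY nzY _]] := nut_in_ker nutG.
pose Z i := if odd i then 0 else Y i.
suff /eqP : Z 0%N = 0 by rewrite (negPf (nzY 0%N)).
apply: (@nut_ker_eq0 _ 1) => // [i|i].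
  by rewrite /Z perY oddD (negPf m_even) addbF.
have := kerY i; rewrite /shift_add /Z.
rewrite !oddD oddB ?(ltnW a_lt_b) // (negPf even_a) even_b !addbF.
by case: (odd i); rewrite // !addr0.
Qed.

(** The witness lives on the multiples of the gcd [g], with the sign (-1)^i. The shift by the odd
    [c] preserves this support and flips the sign; the even period preserves both. *)
Lemma nut_coprime c : odd c -> c \in [:: a; b] ->
  nut_graph R (@B3 m a b) -> gcdn m c = 1%N.
Proof.
move=> oddc c_ab nutG; apply/eqP/negPn/negP; set g := gcdn m c => g_neq1.
pose Z i : R := (g %| i)%:R * (-1) ^+ i.
suff /eqP : Z 0%N = 0 by rewrite /Z dvdn0 mulr1 oner_eq0.
apply: (@nut_ker_eq0 _ 1) => // [i||].
- rewrite /Z dvdn_addl ?dvdn_gcdl // exprD -(signr_odd _ m) (negPf m_even).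
  by rewrite mulr1.
- apply: (@in_ker_shift_add c) => [|i].
    by move: c_ab; rewrite !inE => /orP[]->; rewrite ?orbT.
  rewrite /shift_add /Z dvdn_addl ?dvdn_gcdr // exprD -(signr_odd _ c) oddc.
  by rewrite mulrN1 mulrN subrr.
by rewrite /Z dvdn1 (negPf g_neq1) mul0r.
Qed.

(** With [q] the 2-part of [d], the witness alternates along the multiples of [q] and is zero
    elsewhere: [m %/ q] is even, giving the period, and [d %/ q] is odd, so 1 + S^d annihilates it.
    Equal parities of [a] and [b] make [q] even, hence the zero at 1. *)
Lemma nut_logn : odd a = odd b -> nut_graph R (@B3 m a b) ->
  (logn 2 m <= logn 2 (b - a))%N.
Proof.
move=> odd_ab nutG; rewrite leqNgt; apply/negP => lt_v2.
set d := (b - a)%N in lt_v2; pose q := (2 ^ logn 2 d)%N.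
have d_gt0 : (0 < d)%N by rewrite subn_gt0.
have q_gt0 : (0 < q)%N by rewrite expn_gt0.
have even_d : (2 %| d)%N.
  by rewrite dvdn2 oddB ?(ltnW a_lt_b) // odd_ab addbb.
have q_neq1 : (q != 1)%N.
  by rewrite -(expn0 2) eqn_exp2l // -lt0n logn_gt0 mem_primes d_gt0 even_d.
have dvd_qm : (q %| m)%N by rewrite pfactor_dvdn // ltnW.
have dvd_qd : (q %| d)%N by rewrite pfactor_dvdn.
have even_mq : odd (m %/ q) = false.
  apply/negbTE; rewrite -dvdn2 -(dvdn_pmul2r q_gt0) divnK // -expnS.
  by rewrite pfactor_dvdn.
have odd_dq : odd (d %/ q).
  rewrite -[odd _]negbK -dvdn2 -(dvdn_pmul2r q_gt0) divnK // -expnS.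
  by rewrite pfactor_dvdn // ltnn.
pose Z i : R := (q %| i)%:R * (-1) ^+ (i %/ q).
suff /eqP : Z 0%N = 0 by rewrite /Z dvdn0 div0n mulr1 oner_eq0.
apply: (@nut_ker_eq0 _ 1) => // [i||].
- rewrite /Z dvdn_addl // divnDr // exprD -(signr_odd _ (m %/ q)) even_mq.
  by rewrite mulr1.
- apply: (@in_ker_shift_add d) => [|i]; first by rewrite !inE eqxx !orbT.
  rewrite /shift_add /Z dvdn_addl // divnDr // exprD.
  by rewrite -(signr_odd _ (d %/ q)) odd_dq mulrN1 mulrN subrr.
by rewrite /Z dvdn1 (negPf q_neq1) mul0r.
Qed.

End B3Kernel.

Theorem theorem5p1 (R : realType) (m a b : nat)
  (hm : (4 <= m)%N) (m_even : ~~ odd m)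
  (hab_parity : odd a = odd b)
  (ha : (1 <= a)%N) (hab : (a < b)%N) (hb : (b < m)%N) :
  nut_graph R (@B3 m a b) <->
  [/\ odd a, odd b, gcdn m a = 1%N, gcdn m b = 1%N
    & (logn 2 m <= logn 2 (b - a))%N].
Proof.
have m_gt0 : (0 < m)%N by apply: leq_trans hm.
split=> [nutG|[odda oddb /eqP co_a /eqP co_b le_v2]].
  have odda := nut_odd m_gt0 m_even ha hab hb hab_parity nutG.
  have oddb : odd b by rewrite -hab_parity.
  split=> //; last exact: (nut_logn m_gt0 m_even ha hab hb hab_parity nutG).
    apply: (nut_coprime m_gt0 m_even ha hab hb odda _ nutG).
    by rewrite !inE eqxx.
  apply: (nut_coprime m_gt0 m_even ha hab hb oddb _ nutG).
  by rewrite !inE eqxx orbT.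
apply: (nut_of_sign m_gt0 m_even ha hab hb odda oddb) => Z perZ kerZ.
exists (Z 0%N).
exact: (in_ker_sign m_gt0 m_even ha hab hb co_a co_b le_v2 perZ kerZ).
Qed.
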